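(* Let $G$ be a weighted, undirected, simple graph on $n$ vertices with exactly $q$ connected components $G_1,\dots,G_q$, $q<n$, and let $\widetilde G$ be a graph obtained from $G$ by adding (positively weighted) edges between different components of $G$. Let $L,\widetilde L$ be the weighted Laplacian matrices of $G,\widetilde G$, let $N=\{1,\dots,n\}$ and $J=\{1,2,\dots,q\}$ (so $\mathrm{span}(\mathbf{u}_J)$ is the null-space of $L$). If $$\max_{j\in\{1,\dots,q\}}\mathcal{MED}_{\widetilde G}(G_j)<\frac{\lambda_{q+1}}{4},$$ then $$d_{\mathrm{sp}}\left(\mathrm{span}(\mathbf{u}_J),\mathrm{span}(\widetilde{\mathbf{u}}_{\widehat J})\right)\le\frac{\sqrt{\frac1q\sum_{j=1}^q\mathcal{CP}_{\widetilde G}(G_j)}}{\lambda_{q+1}-2\max_{k\in\{1,\dots,q\}}\mathcal{MED}_{\widetilde G}(G_k)}\le\frac{2\max_{j\in\{1,\dots,q\}}\mathcal{MED}_{\widetilde G}(G_j)}{\lambda_{q+1}-2\max_{j\in\{1,\dots,q\}}\mathcal{MED}_{\widetilde G}(G_j)},$$ where $\widehat J=\{1,2,\dots,q\}=\left\{j'\in N\ \middle|\ \min_{j\in N}|\widetilde\lambda_{j'}-\lambda_j|=\widetilde\lambda_{j'}\right\}$.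
   Context: Graph conventions: a graph has vertex set $\{v_1,\dots,v_n\}$ and a symmetric weighted adjacency matrix with zero diagonal whose $(k,l)$ entry is the positive weight of the edge $(v_k,v_l)$ if it exists and $0$ otherwise. The weighted degree matrix is diagonal with entries the row sums of the adjacency matrix, and the Laplacian is degree matrix minus adjacency matrix. $A,\widetilde A$ are the adjacency matrices of $G,\widetilde G$. $\widetilde G$ has the same vertices as $G$, the same edges and weights within each $G_j$, plus added edges joining different $G_j$'s; so each $G_j$ is an induced subgraph of $\widetilde G$. The eigenvalues of $L$ are $0=\lambda_1=\cdots=\lambda_q\le\lambda_{q+1}\le\cdots\le\lambda_n$ with orthonormal eigenvectors $\mathbf{u}_1,\dots,\mathbf{u}_n$, where for $j\le q$, $\mathbf{u}_j$ is equal to $1/\sqrt{|\mathcal V(G_j)|}$ on the vertices of $G_j$ and $0$ elsewhere ($\mathcal V(\cdot)$ is the vertex set). The eigenvalues of $\widetilde L$ are $0=\widetilde\lambda_1\le\cdots\le\widetilde\lambda_n$ with orthonormal eigenvectors $\widetilde{\mathbf{u}}_1,\dots,\widetilde{\mathbf{u}}_n$. $\mathbf{u}_J=\{\mathbf{u}_j\mid j\in J\}$, similarly for $\widetilde{\mathbf{u}}$. For an induced subgraph $H\subseteq\widetilde G$, the coupling and the maximum external degree of $H$ in $\widetilde G$ are $$\mathcal{CP}_{\widetilde G}(H)=\frac{1}{|\mathcal V(H)|}\left(\sum_{k:\,v_k\in\mathcal V(H)}\Big(\sum_{l:\,v_l\notin\mathcal V(H)}\widetilde A_{kl}\Big)^2+\sum_{l:\,v_l\notin\mathcal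 V(H)}\Big(\sum_{k:\,v_k\in\mathcal V(H)}\widetilde A_{kl}\Big)^2\right),$$ $$\mathcal{MED}_{\widetilde G}(H)=\max_{k:\,v_k\in\mathcal V(H)}\ \sum_{l:\,v_l\notin\mathcal V(H)}\widetilde A_{kl}.$$ Subspace distance: for $q$-dimensional subspaces $X,Y\subseteq\mathbb{C}^n$ with matrices $\mathbf{X},\mathbf{Y}\in\mathbb{C}^{n\times q}$ whose columns are orthonormal bases of $X,Y$, $d_{\mathrm{sp}}(X,Y)=\frac{1}{\sqrt{2q}}\|\mathbf{X}\mathbf{X}^\dagger-\mathbf{Y}\mathbf{Y}^\dagger\|_F$ (Frobenius norm, $^\dagger$ conjugate transpose; independent of the bases). *)

(* Defs.v *)
From HB Require Import structures.
From mathcomp Require Import all_boot all_order all_algebra.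
From mathcomp Require Import reals complex.

Set Implicit Arguments.
Unset Strict Implicit.
Unset Printing Implicit Defensive.

Import Order.TTheory GRing.Theory Num.Theory.
Local Open Scope ring_scope.
Local Open Scope complex_scope.
Local Open Scope sesquilinear_scope.

(* An entry [wadj G k l] is the weight of the edge (v_k, v_l), and 0 when there
   is no such edge. *)
Record wgraph (R : realType) (n : nat) := WGraph {
  wadj :> 'M[R]_n;
  wadj_sym : wadj^T = wadj;
  wadj_diag : forall k, wadj k k = 0;
  wadj_ge0 : forall k l, 0 <= wadj k l }.

Section Graphs.
Context {R : realType} {n : nat}.
Implicit Types (G : wgraph R n) (H : {set 'I_n}).

Definition edge G : rel 'I_n := [rel k l | 0 < G k l].

Definition laplacian G : 'M[R]_n :=
  diag_mx (\row_k \sum_l G k l) - (G : 'M[R]_n).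

Definition components G : {set {set 'I_n}} :=
  equivalence_partition (connect (edge G)) [set: 'I_n].

(* The vertex sets V_1, ..., V_q enumerate the connected components without
   repetition; in particular there are exactly q of them. *)
Definition enum_components G (q : nat) (V : 'I_q -> {set 'I_n}) : Prop :=
  injective V /\ [set V j | j : 'I_q] = components G.

(* Gt and G agree on every pair of vertices of the same component of G; every
   other edge of Gt is an added edge between two components. *)
Definition adds_edges_between_components G (Gt : wgraph R n) : Prop :=
  forall k l, connect (edge G) k l -> Gt k l = G k l.

(* An induced subgraph is given by its vertex set H. *)
Definition coupling G H : R :=
  (#|H|%:R)^-1 *
  (\sum_(k in H) (\sum_(l | l \notin H) G k l) ^+ 2 +
   \sum_(l | l \notin H) (\sum_(k in H) G k l) ^+ 2).

(* The quantities below are nonnegative, so that 0 is a neutral default for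
   the maximum. *)
Definition max_ext_degree G H : R :=
  \big[Num.max/0]_(k in H) \sum_(l | l \notin H) G k l.

Definition max_MED G (q : nat) (V : 'I_q -> {set 'I_n}) : R :=
  \big[Num.max/0]_(j < q) max_ext_degree G (V j).

(* The eigenvalues of M with multiplicity, in nondecreasing order, together
   with an orthonormal basis of eigenvectors. *)
Definition eigensystem (M : 'M[R]_n) (lam : 'I_n -> R)
    (u : 'I_n -> 'cV[R[i]]_n) : Prop :=
  [/\ forall j k : 'I_n, (j <= k)%N -> lam j <= lam k,
      forall j k, (u j)^t* *m u k = (j == k)%:R%:M
    & forall j, map_mx (real_complex R) M *m u j = (lam j)%:C *: u j].

Definition normalized_indicator H : 'cV[R[i]]_n :=
  \col_k (if k \in H then ((Num.sqrt #|H|%:R)^-1)%:C else 0).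

Definition spanI (u : 'I_n -> 'cV[R[i]]_n) (J : {set 'I_n}) :
    {vspace 'cV[R[i]]_n} :=
  <<[seq u j | j in J]>>%VS.

Definition first_indices (q : nat) : {set 'I_n} := [set j : 'I_n | (j < q)%N].

(* { j' | min_j |lamt_j' - lam_j| = lamt_j' }. The default of the minimum is its
   term of index j', so this is the minimum over the nonempty set 'I_n. *)
Definition closest_to_zero (lam lamt : 'I_n -> R) : {set 'I_n} :=
  [set j' : 'I_n |
    \big[Num.min/ `|lamt j' - lam j'|]_(j < n) `|lamt j' - lam j| == lamt j'].

End Graphs.

Section SubspaceDistance.
Context {R : realType} {n : nat}.
Implicit Types (V W : {vspace 'cV[R[i]]_n}).

Definition frobenius (m p : nat) (M : 'M[R[i]]_(m, p)) : R :=
  Num.sqrt (\sum_i \sum_j (ComplexField.Normc.normc (M i j)) ^+ 2).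

Definition orthonormal_basis V (q : nat) (X : 'M[R[i]]_(n, q)) : bool :=
  (X^t* *m X == 1%:M) && (<<[seq col j X | j : 'I_q]>>%VS == V).

Lemma mem_span_cols (q : nat) (X : 'M[R[i]]_(n, q)) (v : 'cV[R[i]]_n) :
  reflect (exists c, v = X *m c) (v \in <<[seq col j X | j : 'I_q]>>%VS).
Proof.
have mulE (c : 'cV_q) : X *m c = \sum_j c j 0 *: col j X.
  apply/matrixP=> i k; rewrite !mxE summxE; apply: eq_bigr => j _.
  by rewrite !mxE mulrC [k]ord1.
apply: (iffP idP) => [|[c ->]]; last first.
  rewrite mulE; apply: memv_suml => j _; apply/memvZ/memv_span.
  exact: image_f.
rewrite span_def big_image /= => /memv_sumP[w wP ->].
have cP j : exists c, w j == c *: col j X.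
  by have /vlineP[c ->] := wP j isT; exists c.
exists (\col_j xchoose (cP j)); rewrite mulE; apply: eq_bigr => j _.
by rewrite mxE; exact/eqP/(xchooseP (cP j)).
Qed.

Lemma orthonormal_basis_dim V (q : nat) (X : 'M[R[i]]_(n, q)) :
  orthonormal_basis V X -> \dim V = q.
Proof.
case/andP=> /eqP XX /eqP <-.
suff : free [tuple col j X | j < q].
  by move/eqP; rewrite [RHS]size_tuple.
apply/freeP => k; under eq_bigr => i _ do rewrite -tnth_nth tnth_mktuple.
move=> k0 i.
have : X *m (\col_j k j) = 0.
  rewrite -[RHS]k0; apply/matrixP=> a b; rewrite !mxE summxE.
  by apply: eq_bigr => j _; rewrite !mxE mulrC.
move/(congr1 (mulmx (X^t*))); rewrite mulmxA XX mul1mx mulmx0.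
by move/matrixP/(_ i 0); rewrite !mxE.
Qed.

Lemma ex_orthonormal_basis V :
  exists X : 'M[R[i]]_(n, \dim V), orthonormal_basis V X.
Proof.
set d := \dim V.
have dn : (d <= n)%N by have := dimvS (subvf V); rewrite dimvf /dim /= muln1.
pose B : 'M[R[i]]_(d, n) := \matrix_(i, j) (vbasis V)`_i j 0.
have BE i : (row i B)^T = (vbasis V)`_i.
  by apply/matrixP=> a b; rewrite !mxE [b]ord1.
pose X := (schmidt B)^T.
have XX : X^t* *m X == 1%:M.
  have /unitarymxP/(congr1 (map_mx Num.conj)) := schmidt_unitarymx B dn.
  rewrite map_mxM map_mx1 => SS; apply/eqP; rewrite -[RHS]SS; congr (_ *m _).
    by apply/matrixP=> a b; rewrite !mxE.
  by apply/matrixP=> a b; rewrite !mxE [RHS]conjCK.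
exists X; rewrite /orthonormal_basis XX eq_sym eqEdim /=.
apply/andP; split; last first.
  rewrite (@orthonormal_basis_dim <<[seq col j X | j : 'I_d]>>%VS d X) //.
  by rewrite /orthonormal_basis XX eqxx.
rewrite -(span_basis (vbasisP V)); apply/span_subvP => _ /tnthP[i ->].
apply/mem_span_cols; have /submxP[D BD] := schmidt_sub B.
exists (row i D)^T; rewrite (tnth_nth 0) -BE BD.
by rewrite row_mul trmx_mul.
Qed.

Definition onb V : 'M[R[i]]_(n, \dim V) := xchoose (ex_orthonormal_basis V).

(* Meant for V and W of the same dimension. The choice of the bases is
   irrelevant, see [d_spE]. *)
Definition d_sp V W : R :=
  (Num.sqrt (2 * (\dim V)%:R))^-1 *
  frobenius (onb V *m (onb V)^t* - onb W *m (onb W)^t*).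

Lemma orthonormal_basis_proj V (p q : nat)
    (X : 'M[R[i]]_(n, p)) (Y : 'M[R[i]]_(n, q)) :
  orthonormal_basis V X -> orthonormal_basis V Y -> X *m X^t* = Y *m Y^t*.
Proof.
have fixl a b (A : 'M[R[i]]_(n, a)) (B : 'M[R[i]]_(n, b)) :
    orthonormal_basis V A -> orthonormal_basis V B ->
    A *m A^t* *m (B *m B^t*) = B *m B^t*.
  move=> /andP[/eqP AA /eqP AV] /andP[_ /eqP BV].
  rewrite mulmxA; congr (_ *m _).
  apply/matrixP=> i j.
  have : col j B \in <<[seq col j A | j : 'I_a]>>%VS.
    by rewrite AV -BV; apply/memv_span/image_f.
  case/mem_span_cols=> c Bc.
  have : A *m A^t* *m col j B = col j B.
    by rewrite Bc !mulmxA -[A *m _ *m A]mulmxA AA mulmx1.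
  move/matrixP/(_ i 0); rewrite [RHS]mxE => <-; rewrite [LHS]mxE [RHS]mxE.
  by apply: eq_bigr => k _; rewrite [col j B k 0]mxE.
have adj a b c (A : 'M[R[i]]_(a, b)) (B : 'M[R[i]]_(b, c)) :
    (A *m B)^t* = B^t* *m A^t* by rewrite trmx_mul map_mxM.
move=> XV YV; have := congr1 (fun M => M^t*) (fixl _ _ _ _ XV YV).
by rewrite !adj !trmxCK fixl.
Qed.

Lemma d_spE V W (q : nat) (X Y : 'M[R[i]]_(n, q)) :
  orthonormal_basis V X -> orthonormal_basis W Y ->
  d_sp V W = (Num.sqrt (2 * q%:R))^-1 * frobenius (X *m X^t* - Y *m Y^t*).
Proof.
move=> XV YW.
rewrite (orthonormal_basis_proj XV (xchooseP (ex_orthonormal_basis V))).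
rewrite (orthonormal_basis_proj YW (xchooseP (ex_orthonormal_basis W))).
by congr ((Num.sqrt (2 * _%:R))^-1 * _); exact: orthonormal_basis_dim XV.
Qed.

End SubspaceDistance.

(* Main.v *)
Require Import Defs.
From HB Require Import structures.
From mathcomp Require Import all_boot all_order all_algebra.
From mathcomp Require Import reals complex ring lra.

Set Implicit Arguments.
Unset Strict Implicit.
Unset Printing Implicit Defensive.

Import Order.TTheory GRing.Theory Num.Theory.
Local Open Scope ring_scope.

(* Write B for the Laplacian of the added edges, so that Lt = L + B with
   0 <= B <= 2 max_MED. By Weyl's inequality, lamt_k <= 2 max_MED for k < q and
   lamt_k >= lam_q for k >= q, which identifies the indices closest to zero.
   Comparing <ut_k, Lt u_j> = lamt_k <ut_k, u_j> with Parseval's identity for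
   Lt u_j, whose squared norm is the coupling of G_j, gives
     lam_q^2 * \sum_(j < q, k >= q) |<ut_k, u_j>|^2 <= \sum_j CP(G_j),
   and the double sum is q times the squared subspace distance. The denominator
   lam_q so obtained is better than the stated one. Finally CP <= 2 max_MED^2,
   each of its two sums contributing at most max_MED^2. *)

(** * Hermitian inner product, Rayleigh quotients and Weyl's inequality *)

Section HermitianProduct.
Local Open Scope complex_scope.
Local Open Scope ring_scope.
Local Open Scope sesquilinear_scope.
Context {R : realType} {n : nat}.
Implicit Types (x y : 'cV[R[i]]_n) (u v : 'I_n -> 'cV[R[i]]_n).

(** The value is kept in [R[i]] even when it is real. The order of [R[i]] compares real parts and
    demands equal imaginary parts, so an inequality between such values also records that their
    difference is real. *)
Definition dot x y : R[i] := (x^t* *m y) 0 0.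

Lemma dotE x y : dot x y = \sum_i (x i 0)^* * y i 0.
Proof. by rewrite /dot mxE; apply: eq_bigr => i _; rewrite !mxE. Qed.

Lemma dot_sqnormE x : dot x x = \sum_i `|x i 0| ^+ 2.
Proof. by rewrite dotE; apply: eq_bigr => i _; rewrite normCK mulrC. Qed.

Lemma dotC x y : dot x y = (dot y x)^*.
Proof.
rewrite !dotE rmorph_sum; apply: eq_bigr => i _.
by rewrite rmorphM/= conjCK mulrC.
Qed.

Lemma dotDr x y z : dot x (y + z) = dot x y + dot x z.
Proof. by rewrite /dot mulmxDr mxE. Qed.

Lemma dotZr x a y : dot x (a *: y) = a * dot x y.
Proof. by rewrite /dot -scalemxAr mxE. Qed.

Lemma dot_gt0 x : x != 0 -> 0 < dot x x.
Proof.
move=> x0; rewrite lt_def dot_sqnormE sumr_ge0 ?andbT; last first.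
  by move=> i _; rewrite exprn_ge0.
apply: contra x0; rewrite psumr_eq0 => [/allP x0|i _]; last first.
  by rewrite exprn_ge0.
apply/eqP/matrixP => i j; rewrite [j]ord1 mxE.
have := x0 i; rewrite mem_index_enum => /(_ isT).
by rewrite sqrf_eq0 normr_eq0 => /eqP.
Qed.

(** The square matrix [W] with columns [v j] has [W^t*] as left inverse, hence also as right
    inverse, so [W^t*] preserves [dot]. *)
Lemma parseval v x y :
    (forall j k, (v j)^t* *m v k = (j == k)%:R%:M) ->
  dot x y = \sum_k (dot (v k) x)^* * dot (v k) y.
Proof.
move=> vv; pose W : 'M[R[i]]_n := \matrix_(i, j) v j i 0.
have WE k z : (W^t* *m z) k 0 = dot (v k) z.
  by rewrite dotE mxE; apply: eq_bigr => i _; rewrite !mxE.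
have WW : W^t* *m W = 1%:M.
  apply/matrixP => j k; have /matrixP/(_ 0 0) := vv j k.
  rewrite !mxE eqxx mulr1n => <-.
  by apply: eq_bigr => i _; rewrite !mxE.
have := dotE (W^t* *m x) (W^t* *m y).
under eq_bigr => k _ do rewrite !WE.
move=> <-; rewrite /dot trmx_mul map_mxM trmxCK mulmxA -[_ *m W *m _]mulmxA.
by rewrite (mulmx1C WW) mulmx1.
Qed.

Lemma dot_symmetric (M : 'M[R]_n) x y : M^T = M ->
  dot x (map_mx (real_complex R) M *m y) = dot (map_mx (real_complex R) M *m x) y.
Proof.
move=> sM; rewrite /dot trmx_mul map_mxM map_trmx sM mulmxA.
congr ((_ *m _ *m _) 0 0); apply/matrixP => i j.
by rewrite !mxE; exact/esym/conjc_real.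
Qed.

Section Eigensystem.
Context (M : 'M[R]_n) (lam : 'I_n -> R) (u : 'I_n -> 'cV[R[i]]_n).
Hypotheses (symM : M^T = M) (hu : eigensystem M lam u).

Lemma dot_eigenvector k x :
  dot (u k) (map_mx (real_complex R) M *m x) = (lam k)%:C * dot (u k) x.
Proof.
have [_ _ eigu] := hu; rewrite dot_symmetric// eigu dotC dotZr rmorphM/=.
by rewrite -dotC; congr (_ * _); exact: conjc_real.
Qed.

Lemma rayleigh x : dot x (map_mx (real_complex R) M *m x) =
  \sum_k (lam k)%:C * `|dot (u k) x| ^+ 2.
Proof.
have [_ uu _] := hu; rewrite (parseval _ _ uu); apply: eq_bigr => k _.
by rewrite dot_eigenvector normCK; ring.
Qed.

Lemma eigenvector_sqnorm x : dot x x = \sum_k `|dot (u k) x| ^+ 2.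
Proof.
have [_ uu _] := hu; rewrite (parseval _ _ uu); apply: eq_bigr => k _.
by rewrite normCK mulrC.
Qed.

(** Only the coordinates of [x] of index at least [k] survive in the eigenbasis, and their
    eigenvalues are at least [lam k]. The next lemma is the mirror image. *)
Lemma rayleigh_ge (k : 'I_n) x :
    (forall j : 'I_n, (j < k)%N -> dot (u j) x = 0) ->
  (lam k)%:C * dot x x <= dot x (map_mx (real_complex R) M *m x).
Proof.
move=> x0; have [mono _ _] := hu; rewrite rayleigh eigenvector_sqnorm mulr_sumr.
apply: ler_sum => j _; have [/x0 ->|kj] := ltnP j k.
  by rewrite normr0 expr0n /= !mulr0.
by rewrite ler_wpM2r ?exprn_ge0// lecR mono.
Qed.

Lemma rayleigh_le (k : 'I_n) x :
    (forall j : 'I_n, (k < j)%N -> dot (u j) x = 0) ->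
  dot x (map_mx (real_complex R) M *m x) <= (lam k)%:C * dot x x.
Proof.
move=> x0; have [mono _ _] := hu; rewrite rayleigh eigenvector_sqnorm mulr_sumr.
apply: ler_sum => j _; have [/x0 ->|kj] := ltnP k j.
  by rewrite normr0 expr0n /= !mulr0.
by rewrite ler_wpM2r ?exprn_ge0// lecR mono.
Qed.

End Eigensystem.

(* The [n - 1] vectors [u j] with [j < k] and [v j] with [j > k] do not span
   the space. *)
Lemma ex_orthogonal_vector u v (k : 'I_n) : exists x,
  [/\ x != 0, forall j : 'I_n, (j < k)%N -> dot (u j) x = 0
    & forall j : 'I_n, (k < j)%N -> dot (v j) x = 0].
Proof.
(* Column [k] falls under neither case and is zero, so [A] is singular. The conjugate transpose of a
   left null vector is orthogonal to every other column. *)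
pose A : 'M[R[i]]_n := \matrix_(i, j)
  if (j < k)%N then u j i 0 else if (k < j)%N then v j i 0 else 0.
have /det0P[y y0 yA] : \det A == 0.
  rewrite (expand_det_col _ k) big1// => i _.
  by rewrite mxE ltnn mul0r.
have yE j : \sum_i y 0 i * A i j = 0.
  by move/matrixP/(_ 0 j): yA; rewrite !mxE.
exists (y^t*); split.
- by rewrite map_mx_eq0 trmx_eq0.
- move=> j jk; rewrite dotC dotE.
  apply/eqP; rewrite conjC_eq0; apply/eqP; rewrite -[RHS](yE j).
  by apply: eq_bigr => i _; rewrite !mxE conjCK jk.
- move=> j jk; rewrite dotC dotE.
  apply/eqP; rewrite conjC_eq0; apply/eqP; rewrite -[RHS](yE j).
  by apply: eq_bigr => i _; rewrite !mxE conjCK jk ltnNge ltnW.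
Qed.

(** A nonzero vector orthogonal to the eigenvectors of [M] below [k] and to those of [N] above [k]
    has Rayleigh quotient at least [lam k] for [M] and at most [mu k] for [N]. *)
Lemma weyl_le (M N : 'M[R]_n) (c : R) (lam mu : 'I_n -> R) u v :
    M^T = M -> N^T = N -> eigensystem M lam u -> eigensystem N mu v ->
    (forall x, dot x (map_mx (real_complex R) M *m x) <=
       dot x (map_mx (real_complex R) N *m x) + c%:C * dot x x) ->
  forall k, lam k <= mu k + c.
Proof.
move=> sM sN hu hv MN k; have [x [x0 ux vx]] := ex_orthogonal_vector u v k.
rewrite -lecR -(ler_pM2r (dot_gt0 x0)) rmorphD/= mulrDl.
apply: le_trans (rayleigh_ge sM hu ux) _; apply: le_trans (MN x) _.
by rewrite lerD2r; apply: (rayleigh_le sN hv).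
Qed.

End HermitianProduct.

(** * Quadratic form of the Laplacian, and the coupling *)

Section Laplacian.
Local Open Scope complex_scope.
Local Open Scope ring_scope.
Local Open Scope sesquilinear_scope.
Context {R : realType} {n : nat}.
Implicit Types (G : wgraph R n) (x : 'cV[R[i]]_n) (H : {set 'I_n}).

Lemma wadjC G k l : G k l = G l k.
Proof. by rewrite -[in LHS](wadj_sym G) mxE. Qed.

Lemma laplacian_sym G : (laplacian G)^T = laplacian G.
Proof. by rewrite linearB /= tr_diag_mx wadj_sym. Qed.

Lemma laplacian_mulE G x k :
  (map_mx (real_complex R) (laplacian G) *m x) k 0 =
  \sum_l (G k l)%:C * (x k 0 - x l 0).
Proof.
rewrite map_mxB mulmxBl mxE [X in _ + X]mxE.
under [RHS]eq_bigr => l _ do rewrite mulrBr.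
rewrite big_split /= sumrN; congr (_ - _); last first.
  by rewrite mxE; apply: eq_bigr => l _; rewrite mxE.
rewrite map_diag_mx mul_diag_mx !mxE rmorph_sum mulr_suml.
by [].
Qed.

(** Exchanging [k] and [l] gives a second expression of the form by symmetry of the weights. Adding
    the two completes the square, whence the factor one half. *)
Lemma laplacian_quadE G x :
  dot x (map_mx (real_complex R) (laplacian G) *m x) =
  2^-1 * \sum_k \sum_l (G k l)%:C * `|x k 0 - x l 0| ^+ 2.
Proof.
set D := dot _ _.
have D1 : D = \sum_k \sum_l (G k l)%:C * ((x k 0)^* * (x k 0 - x l 0)).
  rewrite /D dotE; apply: eq_bigr => k _; rewrite laplacian_mulE mulr_sumr.
  by apply: eq_bigr => l _; ring.
have D2 : D = \sum_k \sum_l (G k l)%:C * ((x l 0)^* * (x l 0 - x k 0)).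
  rewrite D1 exchange_big; apply: eq_bigr => k _; apply: eq_bigr => l _.
  by rewrite wadjC.
have -> : \sum_k \sum_l (G k l)%:C * `|x k 0 - x l 0| ^+ 2 = D + D.
  rewrite {1}D1 D2 -big_split; apply: eq_bigr => k _.
  rewrite -big_split; apply: eq_bigr => l _.
  by rewrite normCK rmorphB /=; ring.
by field.
Qed.

Lemma laplacian_quad_ge0 G x :
  0 <= dot x (map_mx (real_complex R) (laplacian G) *m x).
Proof.
rewrite laplacian_quadE mulr_ge0 ?invr_ge0 ?ler0n// sumr_ge0// => k _.
by rewrite sumr_ge0// => l _; rewrite mulr_ge0 ?exprn_ge0// ler0c wadj_ge0.
Qed.

(** By the parallelogram identity each squared difference is at most twice the sum of the two
    squares, and each vertex is then weighted by its degree. *)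
Lemma laplacian_quad_le G (m : R) x :
    (forall k, \sum_l G k l <= m) ->
  dot x (map_mx (real_complex R) (laplacian G) *m x) <= (2 * m)%:C * dot x x.
Proof.
move=> degG; rewrite laplacian_quadE.
have norm2B (a b : R[i]) : `|a - b| ^+ 2 <= 2 * `|a| ^+ 2 + 2 * `|b| ^+ 2.
  rewrite -subr_ge0.
  suff -> : 2 * `|a| ^+ 2 + 2 * `|b| ^+ 2 - `|a - b| ^+ 2 = `|a + b| ^+ 2.
    by rewrite exprn_ge0.
  by rewrite !normCK rmorphB rmorphD /=; ring.
pose S := \sum_k \sum_l (G k l)%:C * `|x k 0| ^+ 2.
have S' : \sum_k \sum_l (G k l)%:C * `|x l 0| ^+ 2 = S.
  rewrite /S exchange_big; apply: eq_bigr => k _; apply: eq_bigr => l _.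
  by rewrite wadjC.
have : \sum_k \sum_l (G k l)%:C * `|x k 0 - x l 0| ^+ 2 <= 2 * S + 2 * S.
  rewrite -{2}S' /S !mulr_sumr -big_split; apply: ler_sum => k _.
  rewrite !mulr_sumr -big_split; apply: ler_sum => l _.
  rewrite /= [2 * (_ * _)]mulrCA [2 * (_ * `|x l 0| ^+ 2)]mulrCA -mulrDr.
  by rewrite ler_wpM2l ?norm2B// ler0c wadj_ge0.
rewrite -(@ler_pM2l _ 2^-1) ?invr_gt0 ?ltr0n// => /le_trans; apply.
have -> : 2^-1 * (2 * S + 2 * S) = 2 * S by field.
rewrite rmorphM rmorph_nat -mulrA ler_pM2l ?ltr0n//.
rewrite dot_sqnormE mulr_sumr; apply: ler_sum => k _.
by rewrite -mulr_suml ler_wpM2r ?exprn_ge0// -rmorph_sum lecR.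
Qed.

Lemma laplacian_normalized_indicator G H k :
  (map_mx (real_complex R) (laplacian G) *m normalized_indicator H) k 0 =
  (Num.sqrt #|H|%:R)^-1%:C *
  (if k \in H then \sum_(l | l \notin H) G k l
   else - \sum_(l in H) G k l)%:C.
Proof.
rewrite laplacian_mulE.
under eq_bigr => l _ do rewrite !mxE.
case: ifP => kH.
  rewrite rmorph_sum mulr_sumr [RHS]big_mkcond /=; apply: eq_bigr => l _.
  by case: (l \in H); rewrite /= ?subrr ?mulr0// subr0 mulrC.
rewrite rmorphN rmorph_sum -sumrN mulr_sumr [RHS]big_mkcond /=.
apply: eq_bigr => l _.
by case: (l \in H); rewrite ?subrr ?mulr0// sub0r mulrN mulrN mulrC.
Qed.

(** The two sums of [coupling] collect the squared entries of [y] at the vertices inside and outside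
    [H]; the prefactor is the squared normalization of the indicator. *)
Lemma sqnorm_laplacian_indicator G H :
  let y := map_mx (real_complex R) (laplacian G) *m normalized_indicator H in
  dot y y = (coupling G H)%:C.
Proof.
rewrite /= dot_sqnormE /coupling.
have normCR (a : R) : `|a%:C| ^+ 2 = (a ^+ 2)%:C :> R[i].
  by rewrite normCK -[_^*]/(conjc _) conjc_real -rmorphM.
under eq_bigr => k _ do
  rewrite laplacian_normalized_indicator -rmorphM normCR exprMn exprVn
          sqr_sqrtr ?ler0n//.
rewrite -rmorph_sum -mulr_sumr (bigID (mem H)) /=; congr ((_ * (_ + _))%:C).
  by apply: eq_bigr => k ->.
apply: eq_bigr => k /negbTE ->; rewrite sqrrN; congr (_ ^+ 2).
by apply: eq_bigr => l _; rewrite wadjC.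
Qed.

Lemma ext_degree_le G H k : k \in H ->
  \sum_(l | l \notin H) G k l <= max_ext_degree G H.
Proof. exact: le_bigmax_cond. Qed.

Lemma coupling_le G H (m : R) :
    (forall k, k \in H -> \sum_(l | l \notin H) G k l <= m) ->
    (forall l, l \notin H -> \sum_(k in H) G k l <= m) ->
    0 <= m ->
  coupling G H <= 2 * m ^+ 2.
Proof.
move=> outH inH m0; rewrite /coupling.
have ge0 (P : pred 'I_n) k : 0 <= \sum_(l | P l) G k l.
  by rewrite sumr_ge0// => l _; exact: wadj_ge0.
have ge0' (P : pred 'I_n) l : 0 <= \sum_(k | P k) G k l.
  by rewrite sumr_ge0// => k _; exact: wadj_ge0.
(* For empty [H] the inverse of the cardinality is 0, and so is the coupling. *)
have [->|[h hH]] := set_0Vmem H.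
  by rewrite cards0 invr0 mul0r mulr_ge0// exprn_ge0.
have H0 : 0 < #|H|%:R :> R by rewrite ltr0n card_gt0; apply/set0Pn; exists h.
rewrite mulrC ler_pdivrMr//.
have S1 : \sum_(k in H) (\sum_(l | l \notin H) G k l) ^+ 2 <= #|H|%:R * m ^+ 2.
  rewrite mulr_natl -sumr_const; apply: ler_sum => k kH.
  by rewrite lerXn2r ?nnegrE ?outH.
have S2 : \sum_(l | l \notin H) (\sum_(k in H) G k l) ^+ 2 <= #|H|%:R * m ^+ 2.
  (* The number of vertices outside [H] must not enter the bound: only one factor of each square is
     bounded by [m], and the remaining double sum is reorganized as external degrees of the vertices
     of [H]. *)
  apply: (@le_trans _ _ (m * \sum_(l | l \notin H) \sum_(k in H) G k l)).
    rewrite mulr_sumr; apply: ler_sum => l lH.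
    by rewrite expr2 ler_wpM2r ?inH.
  rewrite exchange_big /= expr2 mulrCA ler_wpM2l// mulr_natl -sumr_const.
  by apply: ler_sum => k kH; exact: outH.
apply: le_trans (lerD S1 S2) _.
by rewrite le_eqVlt; apply/orP; left; apply/eqP; ring.
Qed.

End Laplacian.

(** * Subspace distance in terms of inner products of basis vectors *)

Section SubspaceDistance.
Local Open Scope complex_scope.
Local Open Scope ring_scope.
Local Open Scope sesquilinear_scope.
Context {R : realType} {n q : nat} (leqn : (q <= n)%N).
Implicit Types (u v : 'I_n -> 'cV[R[i]]_n).

Let w := widen_ord leqn.

Definition first_columns u : 'M[R[i]]_(n, q) := \matrix_(i, j) u (w j) i 0.

Lemma first_columns_dot u v j k :
  ((first_columns u)^t* *m first_columns v) j k = dot (u (w j)) (v (w k)).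
Proof. by rewrite dotE mxE; apply: eq_bigr => i _; rewrite !mxE. Qed.

Lemma first_columns_orthonormal_basis u :
    (forall j k, (u j)^t* *m u k = (j == k)%:R%:M) ->
  orthonormal_basis (spanI u (first_indices q)) (first_columns u).
Proof.
move=> uu; apply/andP; split.
  apply/eqP/matrixP => j k; rewrite first_columns_dot /dot uu !mxE eqxx mulr1n.
  by congr (_%:R); rewrite (inj_eq (inj_comp _ _))//; apply: widen_ord_inj.
apply/eqP/eq_span => x.
have colE j : col j (first_columns u) = u (w j).
  by apply/matrixP => i k; rewrite !mxE [k]ord1.
apply/imageP/imageP => [[j _ ->]|[j]].
  by exists (w j); rewrite ?inE ?colE//=.
rewrite inE => jq ->; exists (Ordinal jq) => //; rewrite colE.
by congr u; apply: val_inj.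
Qed.

Lemma mxtrace_mul_adjoint m p (A : 'M[R[i]]_(m, p)) :
  \tr (A *m A^t*) = \sum_i \sum_j `|A i j| ^+ 2.
Proof.
apply: eq_bigr => i _; rewrite mxE; apply: eq_bigr => j _.
by rewrite !mxE normCK.
Qed.

(** For the projections P and Q, the trace of (P - Q)(P - Q) expands to tr P + tr Q - 2 tr PQ. The
    first two traces are [q], and by cyclicity tr PQ is the squared Frobenius norm of
    [X^t* *m Y]. *)
Lemma frobenius_proj_sub (X Y : 'M[R[i]]_(n, q)) :
    X^t* *m X = 1%:M -> Y^t* *m Y = 1%:M ->
  \sum_i \sum_j `|(X *m X^t* - Y *m Y^t*) i j| ^+ 2 =
  2 * (q%:R - \sum_j \sum_k `|(X^t* *m Y) j k| ^+ 2).
Proof.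
move=> XX YY; rewrite -!mxtrace_mul_adjoint.
have adjM a b c (A : 'M[R[i]]_(a, b)) (B : 'M[R[i]]_(b, c)) :
    (A *m B)^t* = B^t* *m A^t* by rewrite trmx_mul map_mxM.
have adjB (A B : 'M[R[i]]_n) : (A - B)^t* = A^t* - B^t*.
  by rewrite linearB map_mxB.
have trP (Z : 'M[R[i]]_(n, q)) : Z^t* *m Z = 1%:M ->
    \tr (Z *m Z^t* *m (Z *m Z^t*)) = q%:R.
  move=> ZZ; rewrite mulmxA -[Z *m Z^t* *m Z]mulmxA ZZ mulmx1.
  by rewrite mxtrace_mulC ZZ mxtrace1.
have trPQ : \tr (X *m X^t* *m (Y *m Y^t*)) = \tr (X^t* *m Y *m (Y^t* *m X)).
  by rewrite -mulmxA mxtrace_mulC !mulmxA.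
rewrite adjB !adjM !trmxCK mulmxBl !mulmxBr !linearB /= !trP//.
by rewrite [\tr (Y *m _ *m (X *m _))]mxtrace_mulC trPQ; ring.
Qed.

Lemma d_sp_spanI_le u v (S : R) :
    (forall j k, (u j)^t* *m u k = (j == k)%:R%:M) ->
    (forall j k, (v j)^t* *m v k = (j == k)%:R%:M) ->
    \sum_(j < q) \sum_(k < n | (q <= k)%N) `|dot (v k) (u (w j))| ^+ 2 <= S%:C ->
  d_sp (spanI u (first_indices q)) (spanI v (first_indices q))
    <= Num.sqrt (q%:R^-1 * S).
Proof.
move=> uu vv leS.
have bu := first_columns_orthonormal_basis uu.
have bv := first_columns_orthonormal_basis vv.
rewrite (d_spE bu bv) /frobenius; set F := \sum_i _.
have FS : F <= 2 * S.
  rewrite -lecR rmorphM rmorph_nat; apply: le_trans (ler_wpM2l (ler0n _ 2) leS).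
  have -> : F%:C = \sum_i \sum_j
      `|(first_columns u *m (first_columns u)^t*
          - first_columns v *m (first_columns v)^t*) i j| ^+ 2.
    rewrite rmorph_sum; apply: eq_bigr => i _.
    by rewrite rmorph_sum; apply: eq_bigr => j _; rewrite rmorphXn.
  rewrite frobenius_proj_sub; [|exact/eqP/(andP bu).1|exact/eqP/(andP bv).1].
  rewrite ler_pM2l ?ltr0n// -[X in X%:R]card_ord -sumr_const -sumrB.
  apply: ler_sum => j _.
  (* Each of the [q] units is the squared norm of some [u (w j)], expanded over [v]; subtracting the
     overlaps with the first [q] vectors leaves those with [q <= k]. *)
  have -> : 1 = \sum_k `|dot (v k) (u (w j))| ^+ 2.
    have /matrixP/(_ 0 0) := uu (w j) (w j).
    rewrite -[LHS]/(dot _ _) [RHS]mxE !eqxx !mulr1n => <-.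
    by rewrite (parseval _ _ vv); apply: eq_bigr => k _; rewrite normCK mulrC.
  rewrite (bigID (fun k : 'I_n => (k < q)%N)) /= big_ord_narrow.
  under [X in _ - X]eq_bigr => k _ do
    rewrite first_columns_dot dotC norm_conjC.
  rewrite addrC addrK le_eqVlt; apply/orP; left; apply/eqP.
  by apply: eq_bigl => k; rewrite -leqNgt.
have q2 : 0 <= (2 * q%:R : R)^-1 by rewrite invr_ge0 mulr_ge0.
(* The factor 2 in [FS] cancels the 2 in the normalization of [d_sp]. *)
rewrite -sqrtrV ?mulr_ge0// -sqrtrM// ler_wsqrtr//.
by rewrite (le_trans (ler_wpM2l q2 FS))// invfM mulrACA mulVf ?pnatr_eq0// mul1r.
Qed.

End SubspaceDistance.

(** * The graph of added edges *)

Section Components.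
Context {R : realType} {n q : nat} (G Gt : wgraph R n) (V : 'I_q -> {set 'I_n}).
Hypotheses (hV : enum_components G V) (hGt : adds_edges_between_components G Gt).

Lemma connect_edge_sym : connect_sym (edge G).
Proof. by apply: sym_connect_sym => k l; rewrite /edge /= wadjC. Qed.

Lemma mem_component j k l : k \in V j -> (l \in V j) = connect (edge G) k l.
Proof.
have : V j \in components G by rewrite -hV.2 imset_f.
case/imsetP => x _ ->; rewrite !inE /= => xk.
by rewrite (same_connect connect_edge_sym xk).
Qed.

Lemma ex_component k : exists j, k \in V j.
Proof.
have : [set l in [set: 'I_n] | connect (edge G) k l] \in components G.
  by apply: imset_f; rewrite inE.
by rewrite -hV.2 => /imsetP[j _ Vj]; exists j; rewrite -Vj !inE /=.
Qed.

Lemma weight_out_component j k l : k \in V j -> l \notin V j -> G k l = 0.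
Proof.
move=> kV; rewrite (mem_component l kV) => kl.
apply/eqP; rewrite eq_le wadj_ge0 andbT leNgt.
by apply: contra kl => kl; exact: connect1.
Qed.

Definition added_mx : 'M[R]_n := (Gt : 'M[R]_n) - (G : 'M[R]_n).

Fact added_sym : added_mx^T = added_mx.
Proof. by rewrite linearB /= !wadj_sym. Qed.

Fact added_diag k : added_mx k k = 0.
Proof. by rewrite !mxE !wadj_diag subr0. Qed.

Fact added_ge0 k l : 0 <= added_mx k l.
Proof.
rewrite !mxE; have [kl|kl] := boolP (connect (edge G) k l).
  by rewrite hGt// subrr.
have [j kV] := ex_component k.
by rewrite (weight_out_component kV) ?subr0 ?wadj_ge0// (mem_component _ kV).
Qed.

(** Packaging the difference as a [wgraph] makes the bounds on Laplacian forms apply to the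
    perturbation. *)
Definition added_graph := WGraph added_sym added_diag added_ge0.

Lemma added_graphE k l : added_graph k l = Gt k l - G k l.
Proof. by rewrite -[LHS]/(added_mx k l) !mxE. Qed.

Lemma laplacian_added : laplacian Gt = laplacian G + laplacian added_graph.
Proof.
apply/matrixP => k l; rewrite !mxE.
have -> : \sum_l added_graph k l = \sum_l Gt k l - \sum_l G k l.
  by rewrite -sumrB; apply: eq_bigr => i _; rewrite added_graphE.
by rewrite mulrnBl; ring.
Qed.

Lemma max_ext_degree_le_MED j : max_ext_degree Gt (V j) <= max_MED Gt V.
Proof. exact: (le_bigmax _ (fun j => max_ext_degree Gt (V j))). Qed.

Lemma ext_degree_le_MED j k : k \in V j ->
  \sum_(l | l \notin V j) Gt k l <= max_MED Gt V.
Proof.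
by move/(ext_degree_le Gt)/le_trans; apply; exact: max_ext_degree_le_MED.
Qed.

Lemma max_MED_ge0 : 0 <= max_MED Gt V.
Proof. exact: bigmax_ge_id. Qed.

(** Added weights vanish inside the component of [k] and equal those of [Gt] outside it, so this
    degree is the external degree of [k]. *)
Lemma degree_added_le k : \sum_l added_graph k l <= max_MED Gt V.
Proof.
have [j kV] := ex_component k.
apply: le_trans (ext_degree_le_MED kV).
rewrite (bigID (mem (V j))) /= big1 ?add0r => [|l lV]; last first.
  by rewrite added_graphE hGt ?subrr// -(mem_component _ kV).
apply: ler_sum => l lV.
by rewrite added_graphE (weight_out_component kV lV) subr0.
Qed.

(** A vertex [l] outside [V j] lies in another component [V j'], and its edges into [V j] all leave
    [V j']. Their total weight is thus at most the external degree of [l] with respect to [V j']. *)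
Lemma coupling_component_le j : coupling Gt (V j) <= 2 * max_MED Gt V ^+ 2.
Proof.
apply: coupling_le max_MED_ge0 => [k kV|l lV]; first exact: ext_degree_le_MED.
have [j' lV'] := ex_component l.
apply: le_trans (ext_degree_le_MED lV').
rewrite big_mkcond [leRHS]big_mkcond; apply: ler_sum => k _; rewrite wadjC.
have [kV|_] := boolP (k \in V j); last by case: ifP => _; rewrite ?wadj_ge0.
rewrite (mem_component _ lV') connect_edge_sym -(mem_component _ kV).
by rewrite lV.
Qed.

End Components.

(** * Eigenvalue localization and the final estimates *)

Theorem proposition4 (R : realType) (n q : nat) (hqn : (q < n)%N)
    (G Gt : wgraph R n) (V : 'I_q -> {set 'I_n})
    (hV : enum_components G V)
    (hGt : adds_edges_between_components G Gt)
    (lam lamt : 'I_n -> R) (u ut : 'I_n -> 'cV[R[i]]_n)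
    (hu : eigensystem (laplacian G) lam u)
    (hu_ind : forall j : 'I_q,
       u (widen_ord (ltnW hqn) j) = normalized_indicator (V j))
    (hut : eigensystem (laplacian Gt) lamt ut)
    (hMED : max_MED Gt V < lam (Ordinal hqn) / 4) :
  let J : {set 'I_n} := first_indices q in
  let Jhat : {set 'I_n} := first_indices q in
  [/\ Jhat = closest_to_zero lam lamt,
      d_sp (spanI u J) (spanI ut Jhat)
        <= Num.sqrt (q%:R^-1 * \sum_(j < q) coupling Gt (V j))
             / (lam (Ordinal hqn) - 2 * max_MED Gt V)
    & Num.sqrt (q%:R^-1 * \sum_(j < q) coupling Gt (V j))
          / (lam (Ordinal hqn) - 2 * max_MED Gt V)
        <= 2 * max_MED Gt V / (lam (Ordinal hqn) - 2 * max_MED Gt V)].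
Proof.
move=> J Jhat.
have [lam_mono uu eigu] := hu; have [lamt_mono utut _] := hut.
have lsym := laplacian_sym.
have m0 := max_MED_ge0 Gt V; set m := max_MED Gt V in m0 hMED *.
set lq := lam (Ordinal hqn) in hMED *.
set S := \sum_(j < q) coupling Gt (V j).
have lq4 : 4 * m < lq by rewrite mulrC -ltr_pdivlMr ?ltr0n.
have lq0 : 0 < lq by lra.
have gap0 : 0 < lq - 2 * m by lra.
have q0 : (0 < q)%N.
  by have [j _] := ex_component hV (Ordinal hqn); apply: leq_ltn_trans (ltn_ord j).
have quadD x : dot x (map_mx (real_complex R) (laplacian Gt) *m x) =
    dot x (map_mx (real_complex R) (laplacian G) *m x) +
    dot x (map_mx (real_complex R) (laplacian (added_graph hV hGt)) *m x).
  by rewrite (laplacian_added hV hGt) map_mxD mulmxDl dotDr.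
have lam_le k : lam k <= lamt k.
  rewrite -[leRHS]addr0; apply: (weyl_le (lsym _ _ _) (lsym _ _ _) hu hut) => x.
  by rewrite quadD rmorph0 mul0r addr0 lerDl laplacian_quad_ge0.
have lamt_le k : lamt k <= lam k + 2 * m.
  apply: (weyl_le (lsym _ _ _) (lsym _ _ _) hut hu) => x.
  rewrite quadD lerD2l; apply: laplacian_quad_le => {}k.
  exact: degree_added_le.
(* No edge of [G] leaves a component, so the Laplacian annihilates its normalized indicator; pairing
   the eigenvalue equation with the unit vector [u k'] isolates the eigenvalue. *)
have lam_low (k : 'I_n) : (k < q)%N -> lam k = 0.
  move=> kq; have := eigu k; have -> : k = widen_ord (ltnW hqn) (Ordinal kq).
    exact: val_inj.
  set k' := widen_ord _ _; move/(congr1 (dot (u k'))).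
  have -> : map_mx (real_complex R) (laplacian G) *m u k' = 0.
    apply/matrixP => i c; rewrite [c]ord1 [RHS]mxE hu_ind.
    rewrite laplacian_normalized_indicator; apply/eqP.
    rewrite mulf_eq0; apply/orP; right; apply/eqP; case: ifPn => iV.
      by rewrite big1// => l; exact: (weight_out_component hV).
    rewrite big1 ?oppr0// => l lV; rewrite wadjC.
    exact: (weight_out_component hV lV).
  have -> : dot (u k') 0 = 0 by rewrite /dot mulmx0 mxE.
  by rewrite dotZr {1}/dot uu !mxE !eqxx !mulr1n mulr1 => /esym/complexI.
have lq_le (k : 'I_n) : (q <= k)%N -> lq <= lam k by move=> qk; exact: lam_mono.
have lamt0 k : 0 <= lamt k.
  have [/lam_low kq|/lq_le kq] := ltnP k q; have := lam_le k; lra.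
split.
- apply/setP => k; rewrite !inE; have [kq|qk] := ltnP k q.
    apply/esym/eqP/le_anti/andP; split.
      (* Index 0 attains the value [lamt k], because [lam] vanishes there. *)
      apply: (bigmin_inf (Ordinal (leq_trans q0 (ltnW hqn)))) => //.
      by rewrite lam_low// subr0 ger0_norm.
    have lamt2m := lamt_le k; rewrite lam_low// add0r in lamt2m.
    have far j : lamt k <= `|lamt k - lam j|.
      have [/lam_low ->|/lq_le qj] := ltnP j q.
        by rewrite subr0 ger0_norm.
      (* The constant 4 of the hypothesis enters here: the distance is at least [lq - 2 * m], which
         exceeds [2 * m] and hence [lamt k]. *)
      rewrite distrC ger0_norm; lra.
    by apply: le_bigmin => // j _; exact: far.
  apply/esym/negbTE; rewrite lt_eqF//.
  (* The term of index [q] is [lamt k - lq], already strictly below [lamt k]. *)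
  apply: le_lt_trans (bigmin_le _ (Ordinal hqn) _) _.
  have := lam_le k; have := lq_le _ qk => ? ?.
  by rewrite -/lq ger0_norm; lra.
- have S0 : 0 <= S.
    apply: sumr_ge0 => j _; rewrite /coupling mulr_ge0 ?invr_ge0//.
    by rewrite addr_ge0// sumr_ge0// => k _; rewrite sqr_ge0.
  pose y j :=
    map_mx (real_complex R) (laplacian Gt) *m u (widen_ord (ltnW hqn) j).
  have yE k j : dot (ut k) (y j) =
      real_complex R (lamt k) * dot (ut k) (u (widen_ord (ltnW hqn) j)).
    exact: (dot_eigenvector (lsym _ _ _) hut).
  apply: le_trans (@d_sp_spanI_le _ _ _ (ltnW hqn) _ _ (S / lq ^+ 2) uu utut _) _.
    rewrite rmorphM fmorphV mulrC ler_pdivlMl ?ltcR ?exprn_gt0//.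
    rewrite rmorph_sum mulr_sumr; apply: ler_sum => j _.
    rewrite /= -sqnorm_laplacian_indicator -hu_ind -/(y j).
    rewrite (eigenvector_sqnorm hut) mulr_sumr.
    (* The terms with [k < q] are nonnegative and dropped; in the others [lamt k] is at least
       [lq]. *)
    rewrite [leRHS](bigID (fun k : 'I_n => (q <= k)%N)) /=.
    rewrite -[leLHS]addr0 lerD ?sumr_ge0// => [|k _]; last by rewrite exprn_ge0.
    apply: ler_sum => k qk; rewrite yE normrM exprMn ler_wpM2r ?exprn_ge0//.
    rewrite rmorphXn ler_sqr ?nnegrE ?normr_ge0 ?ler0c ?(ltW lq0)//.
    rewrite ger0_norm ?ler0c// lecR.
    exact: le_trans (lq_le k qk) (lam_le k).
  (* It remains to weaken the denominator [lq] to the smaller positive [lq - 2 * m]. *)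
  rewrite mulrA sqrtrM ?mulr_ge0 ?invr_ge0// sqrtrV ?exprn_ge0 ?(ltW lq0)//.
  rewrite sqrtr_sqr gtr0_norm// ler_wpM2l ?sqrtr_ge0// lef_pV2 ?posrE//.
  by lra.
- rewrite ler_pM2r ?invr_gt0//.
  rewrite -[leRHS]ger0_norm ?mulr_ge0// -sqrtr_sqr ler_wsqrtr//.
  rewrite ler_pdivrMl ?ltr0n// exprMn.
  (* After squaring, the comparison is termwise, and each coupling is even at most [2 * m ^+ 2]. *)
  have -> : q%:R * (2 ^+ 2 * m ^+ 2) = \sum_(j < q) 4 * m ^+ 2.
    by rewrite sumr_const card_ord -[RHS]mulr_natl; ring.
  apply: ler_sum => j _; apply: le_trans (coupling_component_le Gt hV j) _.
  by rewrite -/m; have := sqr_ge0 m; lra.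
Qed.
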